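(* Let $T$ be a binary tree of size $k$ and let $T'$ be a binary tree of size $m$, where $1\le m\le k$. Let $p_{k,T}:=\mathbb{P}(\mathcal{T}_k=T)$ and $p_{m,T'}:=\mathbb{P}(\mathcal{T}_m=T')$, and let $q^{T}_{T'}$ be the number of subtrees of $T$ that are copies of $T'$. Let $$\beta(k,m):=\frac{4(k+m+3)}{(k+1)(k+2)(m+1)(m+2)}-\frac{4(k^2+3km+m^2+4k+4m+3)}{(k+1)(m+1)(k+m+1)(k+m+2)(k+m+3)}.$$ Let $X_n^{T}$ and $X_n^{T'}$ be the numbers of subtrees of the random binary search tree $\mathcal{T}_n$ that are copies of $T$ and $T'$, respectively. If $n>k+m+1$, then $$\mathrm{Cov}(X_n^{T},X_n^{T'})=(n+1)\sigma_{T,T'},$$ where $$\sigma_{T,T'}:=\frac{2}{(k+1)(k+2)}\,q^{T}_{T'}\,p_{k,T}-\beta(k,m)\,p_{k,T}\,p_{m,T'}.$$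
   Context: Random binary search tree $\mathcal{T}_n$: insert the keys of a uniformly random permutation of $\{1,\dots,n\}$ one by one; the first key is placed at the root, and each later key starts at the root and at each occupied node proceeds to the left child position if it is smaller than the key there and to the right child position if it is larger, until it reaches an empty position, where it is placed. It is regarded as an unlabelled binary tree (each node has possibly a left child and possibly a right child, which are distinguished). The size of a tree is its number of nodes. A subtree always means a fringe subtree: a node together with all its descendants; ''copy'' means isomorphic as a binary tree. *)

(* Defs.v *)
From HB Require Import structures.
From mathcomp Require Import all_boot all_order all_algebra all_fingroup.

Set Implicit Arguments.
Unset Strict Implicit.
Unset Printing Implicit Defensive.

Import GRing.Theory Num.Theory.

(* Unlabelled binary trees.  [Empty] is an empty position, not a node, so that
   a node has an optional left child and an optional right child. *)
Inductive bintree : Type :=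
  | Empty
  | Node (l r : bintree).

Fixpoint bintree_eqb (t u : bintree) : bool :=
  match t, u with
  | Empty, Empty => true
  | Node l r, Node l' r' => bintree_eqb l l' && bintree_eqb r r'
  | _, _ => false
  end.

Lemma bintree_eqP : Equality.axiom bintree_eqb.
Proof.
elim=> [|l IHl r IHr] [|l' r'] /=; try by constructor.
apply: (iffP andP) => [[/IHl-> /IHr->] // | [<- <-]].
by split; [apply/IHl | apply/IHr].
Qed.

HB.instance Definition _ := hasDecEq.Build bintree bintree_eqP.

Fixpoint tree_size (t : bintree) : nat :=
  match t with
  | Empty => 0
  | Node l r => (tree_size l + tree_size r).+1
  end.

(* One fringe subtree per node, with multiplicity. *)
Fixpoint fringe_subtrees (t : bintree) : seq bintree :=
  match t with
  | Empty => [::]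
  | Node l r => t :: fringe_subtrees l ++ fringe_subtrees r
  end.

(* Two unlabelled binary trees are isomorphic iff they are equal as terms. *)
Definition num_copies (u t : bintree) : nat :=
  count_mem u (fringe_subtrees t).

Inductive keytree : Type :=
  | KEmpty
  | KNode (l : keytree) (key : nat) (r : keytree).

Fixpoint bst_insert (t : keytree) (x : nat) : keytree :=
  match t with
  | KEmpty => KNode KEmpty x KEmpty
  | KNode l y r =>
      if x < y then KNode (bst_insert l x) y r
      else KNode l y (bst_insert r x)
  end.

Fixpoint shape_of (t : keytree) : bintree :=
  match t with
  | KEmpty => Empty
  | KNode l _ r => Node (shape_of l) (shape_of r)
  end.

(* 'I_n is {0, ..., n-1}; the successor gives keys in {1, ..., n}. *)
Definition perm_keys (n : nat) (s : 'S_n) : seq nat :=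
  [seq (s i).+1 | i <- enum 'I_n].

(* The random binary search tree T_n, as a random variable on 'S_n. *)
Definition bst (n : nat) (s : 'S_n) : bintree :=
  shape_of (foldl bst_insert KEmpty (perm_keys s)).

Local Open Scope ring_scope.

Section UniformPermutation.
Variables (R : realFieldType) (n : nat).

(* The uniform probability measure on the finite type of permutations; R stands
   for the field of real numbers. *)
Definition perm_prob (A : pred 'S_n) : R := #|A|%:R / #|'S_n|%:R.

Definition perm_expect (X : 'S_n -> R) : R :=
  (\sum_(s : 'S_n) X s) / #|'S_n|%:R.

Definition perm_cov (X Y : 'S_n -> R) : R :=
  perm_expect (fun s => (X s - perm_expect X) * (Y s - perm_expect Y)).

Definition copies_in_bst (u : bintree) (s : 'S_n) : R :=
  (num_copies u (bst s))%:R.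

End UniformPermutation.

Definition bst_prob (R : realFieldType) (k : nat) (t : bintree) : R :=
  perm_prob R [pred s : 'S_k | bst s == t].

Definition beta (R : realFieldType) (k' m' : nat) : R :=
  let k : R := k'%:R in
  let m : R := m'%:R in
  4 * (k + m + 3) / ((k + 1) * (k + 2) * (m + 1) * (m + 2))
  - 4 * (k ^+ 2 + 3 * k * m + m ^+ 2 + 4 * k + 4 * m + 3)
    / ((k + 1) * (m + 1) * (k + m + 1) * (k + m + 2) * (k + m + 3)).

Definition sigma (R : realFieldType) (T T' : bintree) : R :=
  let k := tree_size T in
  let m := tree_size T' in
  2 / ((k%:R + 1) * (k%:R + 2)) * (num_copies T' T)%:R * bst_prob R k T
  - beta R k m * bst_prob R k T * bst_prob R m T'.

(* Main.v *)
Require Import Defs.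
From mathcomp Require Import all_boot all_order all_algebra all_fingroup.
From mathcomp Require Import ring lra zify.

Set Implicit Arguments.
Unset Strict Implicit.
Unset Printing Implicit Defensive.

Import GRing.Theory Num.Theory.

(** Conditionally on the size [i] of its left subtree, the two root subtrees of
    a random binary search tree on [n.+1] keys are independent random binary
    search trees on [i] and [n - i] keys, and [i] is uniform on [0..n]
    ([bst_expect_split]).  On permutations this would be a statement about
    shuffling two sequences; it is cheaper to obtain it from the growth of the
    tree.  The rank of the last key is uniform and independent of the relative
    order of the others, and a key exceeding [j] others lands in the [j]-th
    empty position, counted from 0 on the left, so one step of growth fills a
    uniformly chosen empty position ([bst_expect_grow]).  An urn argument then
    gives the law of the root split by induction: the left subtree, having [i]
    nodes, receives the new node with probability [(i + 1) / (n + 2)].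

    Write [k], [m] for the sizes of [u], [v] and [p], [p'] for their
    probabilities.  In a tree larger than [u], every copy of [u] lies in one of
    the two root subtrees, so the mean [a_n] and the mixed moment [b_n] satisfy
      [(n + 1) a_(n+1) = 2 sum_(i <= n) a_i],
      [(n + 1) b_(n+1) = 2 sum_(i <= n) b_i + 2 c_n],
    where [c_n = sum_(i <= n) a_i a'_(n-i)] comes from the pairs of copies that
    the root separates.  Differencing the first recurrence gives
    [a_n = (n + 1) A p] for [n > k], with [A = 2 / ((k + 1) (k + 2))].
    Differencing the second one gives
      [b_(n+2) / (n + 3) = b_(n+1) / (n + 2)
          + 2 (c_(n+1) - c_n) / ((n + 2) (n + 3))].
    The value of [b_n / (n + 1)] is [A p q], with [q] the number of copies of
    [v] in [u], as long as [c] vanishes, that is for [k < n <= k + m].  The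
    first two nonzero values of [c] are irregular, because [a_k = p] does not
    follow the formula for [n > k]; they produce the two jumps that make up the
    constant [beta].  From then on [c_(n+1) - c_n = A A' p p' (n+2) (n+3) / 2],
    so that [b_n / (n + 1)] increases by [A A' p p'] at each step, exactly as
    [a_n a'_n / (n + 1)] does, and the covariance divided by [n + 1] stays
    constant. *)

Local Open Scope nat_scope.

(** * Growing a search tree at an empty position *)

(** The empty positions are numbered from left to right, starting at 0; a tree
    of size [n] has [n + 1] of them, the first [tree_size l + 1] being in [l]. *)
Fixpoint grow (j : nat) (t : bintree) : bintree :=
  match t with
  | Empty => Node Empty Empty
  | Node l r =>
      if j <= tree_size l then Node (grow j l) r
      else Node l (grow (j - (tree_size l).+1) r)
  end.

Fixpoint keys (t : keytree) : seq nat :=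
  match t with
  | KEmpty => [::]
  | KNode l y r => y :: keys l ++ keys r
  end.

Fixpoint search_tree (t : keytree) : bool :=
  match t with
  | KEmpty => true
  | KNode l y r =>
      [&& all (fun x => x < y) (keys l), all (fun x => y <= x) (keys r),
          search_tree l & search_tree r]
  end.

Fixpoint map_keys (h : nat -> nat) (t : keytree) : keytree :=
  match t with
  | KEmpty => KEmpty
  | KNode l y r => KNode (map_keys h l) (h y) (map_keys h r)
  end.

Lemma shape_map_keys h t : shape_of (map_keys h t) = shape_of t.
Proof. by elim: t => //= l -> y r ->. Qed.

Lemma size_keys t : size (keys t) = tree_size (shape_of t).
Proof. by elim: t => //= l IHl y r IHr; rewrite size_cat IHl IHr. Qed.

Lemma perm_eq_keys_insert t x : perm_eq (keys (bst_insert t x)) (x :: keys t).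
Proof.
elim: t => //= l IHl y r IHr; case: ifP => _ /=; apply/seq.permP => P /=.
  by rewrite !count_cat (seq.permP IHl) /=; lia.
by rewrite !count_cat (seq.permP IHr) /=; lia.
Qed.

Lemma perm_eq_keys_foldl ks t :
  perm_eq (keys (foldl bst_insert t ks)) (ks ++ keys t).
Proof.
elim: ks t => //= x ks IH t; apply: perm_trans (IH _) _.
apply/seq.permP => P.
by rewrite count_cat (seq.permP (perm_eq_keys_insert t x)) /= count_cat; lia.
Qed.

Lemma search_tree_insert t x : search_tree t -> search_tree (bst_insert t x).
Proof.
elim: t => //= l IHl y r IHr /and4P[ltl ger stl str].
case: ltnP => xy /=; rewrite (perm_all _ (perm_eq_keys_insert _ _)) /=.
  by rewrite xy ltl ger IHl.
by rewrite xy ltl ger stl IHr.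
Qed.

Lemma search_tree_foldl ks t :
  search_tree t -> search_tree (foldl bst_insert t ks).
Proof. by elim: ks t => //= x ks IH t st; apply/IH/search_tree_insert. Qed.

(** The empty positions of a search tree correspond to the gaps between its
    consecutive keys, so the rank of the new key alone decides where it goes. *)
Lemma shape_bst_insert t x : search_tree t ->
  shape_of (bst_insert t x) =
    grow (count (fun y => y <= x) (keys t)) (shape_of t).
Proof.
elim: t => //= l IHl y r IHr /and4P[ltl ger stl str].
rewrite count_cat -!size_keys; case: ltnP => xy /=.
  (* All keys to the right of the root exceed [x]. *)
  rewrite [count _ (keys r)](_ : _ = 0) ?addn0 ?add0n; last first.
    apply/eqP; rewrite -leqn0 leqNgt -has_count -all_predC.
    by apply: sub_all ger => z /= yz; rewrite -ltnNge (leq_trans xy).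
  by rewrite count_size IHl.
have /eqP -> : count (fun z => z <= x) (keys l) == size (keys l).
  by rewrite -all_count; apply: sub_all ltl => z zy; lia.
by rewrite ifF; [rewrite IHr //; congr (Node _ (grow _ _)); lia | lia].
Qed.

(** Insertion only compares keys, so it commutes with any increasing
    relabelling of them. *)
Lemma bst_insert_map_keys h t x : {mono h : a b / a < b} ->
  bst_insert (map_keys h t) (h x) = map_keys h (bst_insert t x).
Proof.
move=> hm; elim: t => //= l IHl y r IHr; rewrite hm.
by case: ifP => _ /=; rewrite ?IHl ?IHr.
Qed.

Lemma foldl_map_keys h ks t : {mono h : a b / a < b} ->
  foldl bst_insert (map_keys h t) (map h ks) =
    map_keys h (foldl bst_insert t ks).
Proof.
by move=> hm; elim: ks t => //= x ks IH t; rewrite bst_insert_map_keys // IH.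
Qed.

Lemma bump_mono j : {mono bump j : a b / a < b}.
Proof. by move=> a b; rewrite /bump; lia. Qed.

(** * One step of growth on permutations *)

Lemma size_bst n (s : 'S_n) : tree_size (bst s) = n.
Proof.
rewrite -size_keys (perm_size (perm_eq_keys_foldl _ _)) size_cat addn0.
by rewrite size_map size_enum_ord.
Qed.

(** [lift_perm ord_max j s] inserts a last key of rank [j] and makes room for it
    by shifting the larger keys of [s] up by one. *)
Lemma perm_keys_lift n (j : 'I_n.+1) (s : 'S_n) :
  perm_keys (lift_perm ord_max j s) =
    rcons (map (bump j.+1) (perm_keys s)) j.+1.
Proof.
rewrite /perm_keys enum_ordSr map_rcons lift_perm_id -!map_comp; congr rcons.
apply: eq_map => i /=.
rewrite (_ : widen_ord _ i = lift ord_max i); last first.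
  by apply: val_inj; rewrite /= /bump leqNgt ltn_ord.
by rewrite lift_perm_lift /= bumpS.
Qed.

Lemma count_perm_keys n (s : 'S_n) j : j <= n ->
  count (fun x => x <= j) (perm_keys s) = j.
Proof.
move=> jn; rewrite count_map -sum1_count big_mkcond /= big_enum /=.
rewrite -big_mkcond (reindex_inj (@perm_inj _ s^-1%g)) /=.
under eq_bigl do rewrite permKV.
by rewrite -(big_ord_widen_cond n xpredT (fun=> 1)) // sum1_card card_ord.
Qed.

(** Making room for the last key does not change the shape built by the earlier
    keys, and exactly [j] of them are smaller than it. *)
Lemma bst_lift_perm n (j : 'I_n.+1) (s : 'S_n) :
  bst (lift_perm ord_max j s) = grow j (bst s).
Proof.
rewrite /bst perm_keys_lift foldl_rcons.
rewrite shape_bst_insert ?search_tree_foldl //.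
rewrite (seq.permP (perm_eq_keys_foldl _ _)) cats0 count_map.
rewrite -[KEmpty]/(map_keys (bump j.+1) KEmpty).
rewrite foldl_map_keys; last exact: bump_mono.
rewrite shape_map_keys -[in RHS](count_perm_keys s (leq_ord j)); congr grow.
by apply: eq_count => x; rewrite /= /bump; lia.
Qed.

Local Open Scope ring_scope.

(** A permutation amounts to the image of its last point together with the
    relative order of the other images. *)
Lemma sum_lift_perm (V : nmodType) n (F : 'S_n.+1 -> V) :
  \sum_s F s = \sum_(j < n.+1) \sum_(s : 'S_n) F (lift_perm ord_max j s).
Proof.
pose g (js : 'I_n.+1 * 'S_n) := lift_perm ord_max js.1 js.2.
have g_inj : injective g.
  move=> [j s] [j' s'] /permP eq_g.
  have := eq_g ord_max; rewrite /g /= !lift_perm_id => jj'; subst j'.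
  congr (_, _); apply/permP => i; apply: (@lift_inj _ j).
  by have := eq_g (lift ord_max i); rewrite /g /= !lift_perm_lift.
have g_bij : bijective g.
  by apply: inj_card_bij g_inj _; rewrite card_prod card_ord !card_Sn factS.
by rewrite (reindex g) /= ?pair_bigA //; apply: onW_bij.
Qed.

(** * Expectations over random binary search trees *)

Section Expectation.
Variable R : realFieldType.
Implicit Types f g : bintree -> R.

Definition bst_expect n f : R := perm_expect (fun s : 'S_n => f (bst s)).

Lemma eq_bst_expect n f g : (forall t, tree_size t = n -> f t = g t) ->
  bst_expect n f = bst_expect n g.
Proof.
move=> fg; congr (_ / _); apply: eq_bigr => s _.
by rewrite fg // size_bst.
Qed.

Lemma bst_expectD n f g :
  bst_expect n (fun t => f t + g t) = bst_expect n f + bst_expect n g.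
Proof. by rewrite /bst_expect /perm_expect big_split mulrDl. Qed.

Lemma bst_expectZ n a f :
  bst_expect n (fun t => a * f t) = a * bst_expect n f.
Proof. by rewrite /bst_expect /perm_expect -mulr_sumr mulrA. Qed.

Lemma bst_expect_sum n (I : Type) (r : seq I) (F : I -> bintree -> R) :
  bst_expect n (fun t => \sum_(i <- r) F i t) =
    \sum_(i <- r) bst_expect n (F i).
Proof.
by rewrite /bst_expect /perm_expect exchange_big mulr_suml.
Qed.

Lemma bst_expect_cst n a : bst_expect n (fun=> a) = a.
Proof.
rewrite /bst_expect /perm_expect sumr_const -[a *+ _]mulr_natr mulfK //.
by rewrite card_Sn pnatr_eq0 -lt0n fact_gt0.
Qed.

(** The chain of random binary search trees: the rank of the last key is uniform
    and independent of the tree built by the others. *)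
Lemma bst_expect_grow n f :
  (n.+1)%:R * bst_expect n.+1 f =
    \sum_(j < n.+1) bst_expect n (fun t => f (grow j t)).
Proof.
rewrite /bst_expect /perm_expect sum_lift_perm -mulr_suml.
under eq_bigr do under eq_bigr do rewrite bst_lift_perm.
have n0 : n`!%:R != 0 :> R by rewrite pnatr_eq0 -lt0n fact_gt0.
have n1 : n.+1%:R != 0 :> R by rewrite pnatr_eq0.
by rewrite !card_Sn factS natrM; field; rewrite nat1r n0 n1.
Qed.

(** Expectation over a pair of independent random binary search trees. *)
Definition bst_expect2 i j (F : bintree -> bintree -> R) : R :=
  bst_expect i (fun l => bst_expect j (F l)).

Lemma bst_expect2_exchange i j F :
  bst_expect2 i j F = bst_expect j (fun r => bst_expect i (F^~ r)).
Proof.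
rewrite /bst_expect2 /bst_expect /perm_expect.
under eq_bigr do rewrite mulr_suml.
rewrite exchange_big /= !mulr_suml; apply: eq_bigr => s _.
by rewrite -!mulr_suml mulrAC.
Qed.

(** The law of the root split.  Growing a tree with root subtrees of sizes
    [(i, n - i)] leads to sizes [(i + 1, n - i)] in [i + 1] ways and to
    [(i, n - i + 1)] in [n - i + 1] ways, each time growing one subtree
    uniformly; hence sizes [(a, n + 1 - a)] are reached with total weight
    [a + (n + 1 - a)], which is independent of [a]. *)
Lemma bst_expect_split n f :
  (n.+1)%:R * bst_expect n.+1 f =
    \sum_(i < n.+1) bst_expect2 i (n - i) (fun l r => f (Node l r)).
Proof.
elim: n f => [|n IHn] f.
  rewrite bst_expect_grow !big_ord1 subn0 /bst_expect2.
  have E0 g : bst_expect 0 g = g Empty.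
    by rewrite -[RHS](bst_expect_cst 0); apply: eq_bst_expect => -[].
  by rewrite !E0.
have n1 : n.+1%:R != 0 :> R by rewrite pnatr_eq0.
apply: (mulfI n1).
pose F i j := bst_expect2 i j (fun l r => f (Node l r)).
rewrite bst_expect_grow mulr_sumr.
under eq_bigr do rewrite IHn.
rewrite exchange_big /=.
transitivity (\sum_(i < n.+1) (i.+1%:R * F i.+1 (n - i)%N
                               + (n - i).+1%:R * F i (n - i).+1)).
  apply: eq_bigr => i _.
  have le_in : (i <= n)%N by rewrite -ltnS.
  have En : n.+2 = (i.+1 + (n - i).+1)%N by lia.
  (* The first [i + 1] empty positions of [Node l r] are in [l], the others
     in [r]. *)
  pose G j := bst_expect2 i (n - i) (fun l r => f (grow j (Node l r))).
  rewrite -[LHS]/(\sum_(j < n.+2) G j) En big_split_ord /=; congr (_ + _).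
    rewrite /F [X in _ * X]bst_expect2_exchange -bst_expectZ.
    under eq_bst_expect => r _ do rewrite bst_expect_grow.
    rewrite bst_expect_sum; apply: eq_bigr => j _.
    rewrite -bst_expect2_exchange; apply: eq_bst_expect => l sl.
    by apply: eq_bst_expect => r _; rewrite /= sl -ltnS ltn_ord.
  rewrite /F /bst_expect2 -bst_expectZ.
  under [RHS]eq_bst_expect => l _ do rewrite bst_expect_grow.
  rewrite bst_expect_sum; apply: eq_bigr => j _.
  apply: eq_bst_expect => l sl; apply: eq_bst_expect => r _.
  by rewrite /= sl ifF ?addKn //; lia.
rewrite big_split /=.
(* Both sums are indexed by the new left size; each gains a zero term at one
   end. *)
have -> : \sum_(i < n.+1) i.+1%:R * F i.+1 (n - i)%N
          = \sum_(i < n.+2) i%:R * F i (n.+1 - i)%N.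
  by rewrite [RHS]big_ord_recl mul0r add0r.
have -> : \sum_(i < n.+1) (n - i).+1%:R * F i (n - i).+1
          = \sum_(i < n.+2) (n.+1 - i)%:R * F i (n.+1 - i)%N.
  rewrite [RHS]big_ord_recr /= subnn mul0r addr0.
  by apply: eq_bigr => i _; rewrite subSn // -ltnS.
rewrite -big_split mulr_sumr /=; apply: eq_bigr => i _.
by rewrite -mulrDl -natrD subnKC // -ltnS.
Qed.

Lemma bst_expect2_sep_add i j f g :
  bst_expect2 i j (fun l r => f l + g r) = bst_expect i f + bst_expect j g.
Proof.
rewrite /bst_expect2; under eq_bst_expect => l _.
  rewrite bst_expectD bst_expect_cst; over.
by rewrite bst_expectD bst_expect_cst.
Qed.

Lemma bst_expect2D i j F G :
  bst_expect2 i j (fun l r => F l r + G l r) =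
    bst_expect2 i j F + bst_expect2 i j G.
Proof.
rewrite /bst_expect2 -bst_expectD; apply: eq_bst_expect => l _.
by rewrite bst_expectD.
Qed.

Lemma bst_expect2_sep_mul i j f g :
  bst_expect2 i j (fun l r => f l * g r) = bst_expect i f * bst_expect j g.
Proof.
rewrite /bst_expect2; under eq_bst_expect => l _.
  rewrite bst_expectZ mulrC; over.
by rewrite bst_expectZ mulrC.
Qed.

Lemma bst_expect_eq n u :
  bst_expect n (fun t => (t == u)%:R) = bst_prob R n u.
Proof.
rewrite /bst_prob /perm_prob -sum1_card natr_sum big_mkcond /=.
by congr (_ / _); apply: eq_bigr => s _; rewrite inE; case: eqP.
Qed.

Lemma sum_rev_subn n (F : nat -> R) :
  \sum_(i < n.+1) F (n - i)%N = \sum_(i < n.+1) F i.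
Proof.
rewrite (reindex_inj rev_ord_inj); apply: eq_bigr => i _ /=.
by rewrite subSS subKn // -ltnS.
Qed.

(** * Counting copies of a tree *)

Lemma num_copies_Node u l r :
  num_copies u (Node l r) =
    ((Node l r == u) + (num_copies u l + num_copies u r))%N.
Proof. by rewrite /num_copies /= count_cat. Qed.

Lemma num_copies_small u t :
  (tree_size t < tree_size u)%N -> num_copies u t = 0%N.
Proof.
elim: t => // l IHl r IHr /= lt_u.
rewrite num_copies_Node IHl ?IHr; try lia.
by case: eqP => // E; rewrite -E /= ltnn in lt_u.
Qed.

(** Positivity matters: the empty tree equals itself but has no node, hence no
    fringe subtree. *)
Lemma num_copies_same_size u t :
  (0 < tree_size u)%N -> tree_size t = tree_size u -> num_copies u t = (t == u).
Proof.
case: t => [|l r] /= u0 su; first by rewrite -su in u0.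
by rewrite num_copies_Node !num_copies_small ?addn0 //; lia.
Qed.

Lemma num_copies_big u l r : (tree_size u <= tree_size l + tree_size r)%N ->
  num_copies u (Node l r) = (num_copies u l + num_copies u r)%N.
Proof.
move=> le_u; rewrite num_copies_Node; case: eqP => // E.
by rewrite -E /= ltnn in le_u.
Qed.

(** * The mean number of copies *)

Definition mean_copies u n : R := bst_expect n (fun t => (num_copies u t)%:R).

Lemma mean_copies_small u n : (n < tree_size u)%N -> mean_copies u n = 0.
Proof.
move=> lt_nu; rewrite -[RHS](bst_expect_cst n); apply: eq_bst_expect => t st.
by rewrite num_copies_small // st.
Qed.

Lemma mean_copies_same_size u k : tree_size u = k -> (0 < k)%N ->
  mean_copies u k = bst_prob R k u.
Proof.
move=> <- u0; rewrite -bst_expect_eq; apply: eq_bst_expect => t st.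
by rewrite num_copies_same_size.
Qed.

(** The root of a tree larger than [u] is not the root of a copy of [u], and the
    two root subtrees have the same distribution. *)
Lemma mean_copies_rec u n : (tree_size u <= n)%N ->
  n.+1%:R * mean_copies u n.+1 = 2 * \sum_(i < n.+1) mean_copies u i.
Proof.
move=> le_un; rewrite bst_expect_split.
transitivity (\sum_(i < n.+1) (mean_copies u i + mean_copies u (n - i))).
  apply: eq_bigr => i _; rewrite -bst_expect2_sep_add.
  apply: eq_bst_expect => l sl; apply: eq_bst_expect => r sr.
  by rewrite num_copies_big ?natrD // sl sr subnKC // -ltnS.
by rewrite big_split /= sum_rev_subn; ring.
Qed.

(** The asymptotic proportion, among all nodes, of those whose fringe subtree
    has size [k]. *)
Definition subtree_density k : R := 2 / (k%:R + 1) / (k%:R + 2).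

(** Subtracting consecutive instances of [mean_copies_rec] leaves
    [(n + 2) a_(n+2) = (n + 3) a_(n+1)], so [a_n / (n + 1)] is constant
    for [n > k]; its value is read off at [n = k + 1]. *)
Lemma mean_copies_large u k n : tree_size u = k -> (0 < k < n)%N ->
  mean_copies u n = n.+1%:R * (subtree_density k * bst_prob R k u).
Proof.
move=> su /andP[k_gt0 lt_kn]; rewrite -(subnKC lt_kn) /subtree_density.
have k1 : k%:R + 1 != 0 :> R by rewrite natr1 pnatr_eq0.
have k2 : k%:R + 2 != 0 :> R by rewrite -natrD pnatr_eq0 addn2.
elim: (n - _)%N => [|d IHd].
  rewrite addn0; apply: (@mulfI _ k.+1%:R); first by rewrite pnatr_eq0.
  rewrite mean_copies_rec ?su // big_ord_recr /= big1 ?add0r; last first.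
    by move=> i _; rewrite mean_copies_small ?su.
  by rewrite (mean_copies_same_size su) // -!natr1; field; exact/andP.
rewrite addnS; apply: (@mulfI _ (k.+1 + d).+1%:R); first by rewrite pnatr_eq0.
have le_kd : (k <= k + d)%N by apply: leq_addr.
rewrite addSn in IHd *; rewrite mean_copies_rec ?su; last exact: leqW.
rewrite big_ord_recr mulrDr /= -mean_copies_rec ?su // IHd.
by rewrite -!natr1; field; exact/andP.
Qed.

(** * The mixed second moment *)

Definition mixed_copies u v n : R :=
  bst_expect n (fun t => (num_copies u t)%:R * (num_copies v t)%:R).

(** The contribution of the pairs formed by a copy of [u] in the left root
    subtree and a copy of [v] in the right one, in a tree of size [n + 1] and up
    to the factor [1 / (n + 1)]: the counts in the two subtrees are independent. *)
Definition conv_means u v n : R :=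
  \sum_(i < n.+1) mean_copies u i * mean_copies v (n - i).

Lemma mixed_copies_rec u v n :
  (tree_size u <= n)%N -> (tree_size v <= n)%N ->
  n.+1%:R * mixed_copies u v n.+1 =
    2 * \sum_(i < n.+1) mixed_copies u v i + 2 * conv_means u v n.
Proof.
move=> le_un le_vn; rewrite bst_expect_split.
pose a := mean_copies u; pose b := mean_copies v; pose c := mixed_copies u v.
pose U t : R := (num_copies u t)%:R; pose V t : R := (num_copies v t)%:R.
transitivity (\sum_(i < n.+1) (c i + c (n - i)%N
                               + (a i * b (n - i)%N + b i * a (n - i)%N))).
  apply: eq_bigr => i _; have le_in : (i <= n)%N by rewrite -ltnS.
  rewrite -bst_expect2_sep_add -!bst_expect2_sep_mul -!bst_expect2D.
  apply: eq_bst_expect => l sl; apply: eq_bst_expect => r sr.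
  by rewrite !num_copies_big ?natrD ?sl ?sr ?subnKC // -/(U _) -/(V _); ring.
have conv_sym : \sum_(i < n.+1) b i * a (n - i)%N = conv_means u v n.
  rewrite -(sum_rev_subn n (fun i => b i * a (n - i)%N)).
  by apply: eq_bigr => i _; rewrite subKn ?leq_ord // mulrC.
rewrite !big_split /= (sum_rev_subn n c) conv_sym -/(conv_means u v n).
by ring.
Qed.

(** The difference of two consecutive instances of [mixed_copies_rec]; it
    removes the sum over all smaller sizes. *)
Lemma mixed_copies_step u v n : (tree_size u <= n)%N -> (tree_size v <= n)%N ->
  n.+2%:R * mixed_copies u v n.+2 =
    n.+3%:R * mixed_copies u v n.+1
    + 2 * (conv_means u v n.+1 - conv_means u v n).
Proof.
move=> le_un le_vn; rewrite mixed_copies_rec; try exact: leqW.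
rewrite big_ord_recr /= mulrDr.
rewrite -(addrK (2 * conv_means u v n) (2 * \sum_(i < _) _)).
by rewrite -mixed_copies_rec // -!natr1; ring.
Qed.

Lemma mixed_copies_small u v n : (n < tree_size u)%N -> mixed_copies u v n = 0.
Proof.
move=> lt_nu; rewrite -[RHS](bst_expect_cst n); apply: eq_bst_expect => t st.
by rewrite num_copies_small ?mul0r // st.
Qed.

Lemma mixed_copies_same_size u v : (0 < tree_size u)%N ->
  mixed_copies u v (tree_size u) =
    (num_copies v u)%:R * bst_prob R (tree_size u) u.
Proof.
move=> u0; rewrite -bst_expect_eq -bst_expectZ; apply: eq_bst_expect => t st.
by rewrite num_copies_same_size // mulrC; case: eqP => [->|] //; rewrite !mulr0.
Qed.

Lemma conv_means_small u v n :
  (n < tree_size u + tree_size v)%N -> conv_means u v n = 0.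
Proof.
move=> lt_n; apply: big1 => i _.
have [lt_iu|le_ui] := ltnP i (tree_size u).
  by rewrite mean_copies_small ?mul0r.
by rewrite (@mean_copies_small v) ?mulr0 //; have := ltn_ord i; lia.
Qed.

(** Only the indices with [k <= i] and [m <= n - i] contribute. *)
Lemma conv_means_shift u v k m d : tree_size u = k -> tree_size v = m ->
  conv_means u v (k + m + d) =
    \sum_(j < d.+1) mean_copies u (k + j) * mean_copies v (m + (d - j)).
Proof.
move=> su sv; rewrite /conv_means.
have -> : (k + m + d).+1 = (k + (d.+1 + m))%N by lia.
rewrite big_split_ord big1 => [|i _] /=; last first.
  by rewrite mean_copies_small ?mul0r // su.
rewrite add0r big_split_ord /= -[RHS]addr0; congr (_ + _).
  apply: eq_bigr => j _; congr (_ * mean_copies v _).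
  by have := ltn_ord j; lia.
apply: big1 => i _; rewrite (@mean_copies_small v) ?mulr0 // sv.
by have := ltn_ord i; lia.
Qed.

Lemma sum_opposite_progressions (x y : R) d :
  \sum_(j < d) (x + j%:R) * (y - j%:R) =
    d%:R * x * y + (y - x) * (d%:R * (d%:R - 1) / 2)
    - d%:R * (d%:R - 1) * (2 * d%:R - 1) / 6.
Proof.
elim: d => [|d IHd]; first by rewrite big_ord0; field.
by rewrite big_ord_recr /= IHd -!natr1; field.
Qed.

Lemma perm_cov_mixed u v n :
  perm_cov (@copies_in_bst R n u) (@copies_in_bst R n v) =
    mixed_copies u v n - mean_copies u n * mean_copies v n.
Proof.
rewrite /perm_cov -[perm_expect (copies_in_bst R u)]/(mean_copies u n).
rewrite -[perm_expect (copies_in_bst R v)]/(mean_copies v n).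
set a := mean_copies u n; set b := mean_copies v n.
transitivity (bst_expect n (fun t => (num_copies u t)%:R * (num_copies v t)%:R
   + (- b * (num_copies u t)%:R + (- a * (num_copies v t)%:R + a * b)))).
  by congr (_ / _); apply: eq_bigr => s _; rewrite /copies_in_bst; ring.
rewrite !bst_expectD !bst_expectZ bst_expect_cst.
change (mixed_copies u v n + (- b * a + (- a * b + a * b))
        = mixed_copies u v n - a * b).
by ring.
Qed.

(** * Solving the recurrence for the mixed moment *)

Section Covariance.
Variables (u v : bintree) (k m : nat).
Hypotheses (su : tree_size u = k) (sv : tree_size v = m).
Hypotheses (m_gt0 : (0 < m)%N) (le_mk : (m <= k)%N).

Let p := bst_prob R k u.
Let p' := bst_prob R m v.
Let A := subtree_density k.
Let A' := subtree_density m.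
Let k_gt0 : (0 < k)%N := leq_trans m_gt0 le_mk.

Let nz : [&& k%:R + 1 != 0 :> R, k%:R + 2 != 0 :> R, m%:R + 1 != 0 :> R,
  m%:R + 2 != 0 :> R, k%:R + m%:R + 1 != 0 :> R, k%:R + m%:R + 2 != 0 :> R
  & k%:R + m%:R + 3 != 0 :> R].
Proof.
have k0 := ler0n R k; have m0 := ler0n R m.
by repeat (apply/andP; split); apply: lt0r_neq0; lra.
Qed.

Lemma conv_means_first : conv_means u v (k + m) = p * p'.
Proof.
have := conv_means_shift 0 su sv; rewrite addn0 => ->.
rewrite big_ord1 !addn0.
by rewrite (mean_copies_same_size su) // (mean_copies_same_size sv).
Qed.

(** The two end terms pair a tree of size exactly [k] or [m] with a larger one;
    there the mean is [p] or [p'] and not the value given by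
    [mean_copies_large], which holds for all the inner terms. *)
Lemma conv_means_large d :
  conv_means u v (k + m + d.+1) =
    (A' * (m + d + 2)%:R + A * (k + d + 2)%:R
     + A * A' * \sum_(j < d) ((k + 2)%:R + j%:R) * ((m + d + 1)%:R - j%:R))
    * (p * p').
Proof.
rewrite (conv_means_shift _ su sv) big_ord_recl big_ord_recr /=.
rewrite /bump /= subnn !addn0 subn0.
rewrite (mean_copies_same_size su) // (mean_copies_same_size sv) //.
rewrite (mean_copies_large su) ?(mean_copies_large sv); try lia.
rewrite -/A -/A' -/p -/p'.
under eq_bigr => j _.
  have lt_jd := ltn_ord j.
  rewrite (mean_copies_large su) ?(mean_copies_large sv); try lia.
  rewrite -/A -/A' -/p -/p'.
  rewrite (_ : (k + (1 + j)).+1%:R = (k + 2)%:R + j%:R); last first.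
    by rewrite -natrD; congr _%:R; lia.
  rewrite (_ : (m + (d.+1 - (1 + j))).+1%:R = (m + d + 1)%:R - j%:R); last first.
    by rewrite -natrB; [congr _%:R; lia | lia].
  rewrite (_ : forall x y : R,
    x * (A * p) * (y * (A' * p')) = x * y * (A * A' * (p * p'))); last first.
    by move=> x y; ring.
  over.
rewrite -mulr_suml (_ : (m + d.+1).+1 = m + d + 2)%N; last lia.
rewrite (_ : (k + (1 + d)).+1 = k + d + 2)%N; last lia.
by ring.
Qed.

(** This increment is exactly the one that makes [mixed_copies] grow like the
    product of the means. *)
Lemma conv_means_diff d :
  conv_means u v (k + m + d.+2) - conv_means u v (k + m + d.+1) =
    A * A' * (p * p') * ((k + m + d + 3)%:R * (k + m + d + 4)%:R) / 2.
Proof.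
rewrite !conv_means_large !sum_opposite_progressions !natrD -!natr1.
rewrite /A /A' /subtree_density.
by case/and5P: nz => n1 n2 n3 n4 _; field; exact/and4P.
Qed.

(** Up to size [k + m] the root cannot separate a copy of [u] from a copy of
    [v], so the only source is the tree [u] itself, which holds
    [num_copies v u] copies of [v]. *)
Lemma mixed_copies_below_sum j : (j < m)%N ->
  mixed_copies u v (k + j.+1) =
    (k + j + 2)%:R * (A * (num_copies v u)%:R * p).
Proof.
case/and5P: nz => n1 n2 _ _ _.
elim: j => [|j IHj] lt_jm.
  apply: (@mulfI _ k.+1%:R); first by rewrite pnatr_eq0.
  rewrite addn1 mixed_copies_rec ?su ?sv // conv_means_small; last lia.
  rewrite big_ord_recr /= big1 => [|i _]; last first.
    by rewrite mixed_copies_small // su.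
  rewrite -{1}su mixed_copies_same_size su // -/p !natrD -natr1.
  rewrite /A /subtree_density.
  by field; exact/andP.
apply: (@mulfI _ (k + j).+2%:R); first by rewrite pnatr_eq0.
rewrite !addnS mixed_copies_step ?su ?sv; try lia.
rewrite !conv_means_small; try lia.
rewrite -addnS IHj; last lia.
by rewrite subrr !natrD -!natr1; ring.
Qed.

(** The first term in the parentheses reproduces the product of the two means,
    so [sigma] is what remains for the covariance.  The base case, at size
    [k + m + 2], accumulates the two irregular jumps of the convolution; the
    formula for [beta] is this computation. *)
Lemma mixed_copies_large d :
  mixed_copies u v (k + m + d.+2) =
    (k + m + d + 3)%:R *
      ((k + m + d + 3)%:R * (A * A' * (p * p')) + sigma R u v).
Proof.
case/and5P: nz => n1 n2 n3 n4 /and3P[n5 n6 n7].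
elim: d => [|d IHd].
  have b0 : mixed_copies u v (k + m) =
            (k + m + 1)%:R * (A * (num_copies v u)%:R * p).
    have := @mixed_copies_below_sum m.-1; rewrite prednK // => -> //.
    by congr (_%:R * _); lia.
  have b1 : (k + m + 1)%:R * mixed_copies u v (k + m).+1 =
            (k + m + 2)%:R * mixed_copies u v (k + m) + 2 * (p * p').
    have := @mixed_copies_step u v (k + m).-1.
    rewrite prednK ?addn_gt0 ?k_gt0 //.
    rewrite su sv addn1 addn2 => -> //; try lia.
    rewrite conv_means_first conv_means_small ?su ?sv ?subr0 //; lia.
  have b2 := @mixed_copies_step u v (k + m); rewrite su sv in b2.
  rewrite addn2; apply: (@mulfI _ (k + m).+2%:R); first by rewrite pnatr_eq0.
  rewrite b2; try lia.
  rewrite -[(k + m).+1]addn1 conv_means_large big_ord0 conv_means_first addn1.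
  have k1 : (k + m + 1)%:R != 0 :> R by rewrite addn1 pnatr_eq0.
  have -> : mixed_copies u v (k + m).+1 =
      ((k + m + 2)%:R * mixed_copies u v (k + m) + 2 * (p * p'))
      / (k + m + 1)%:R.
    by rewrite -b1 mulrC mulKf.
  rewrite b0 /sigma /beta su sv -/p -/p' /A /A' /subtree_density.
  rewrite !addn0 -!natr1 !natrD.
  by field; rewrite n1 n2 n3 n4 n5 n6 n7.
apply: (@mulfI _ (k + m + d).+3%:R); first by rewrite pnatr_eq0.
have := @mixed_copies_step u v (k + m + d).+1.
rewrite su sv !addnS => -> //; try lia.
rewrite -!addnS conv_means_diff IHd !addnS -!natr1 !addn0.
by field.
Qed.

End Covariance.
End Expectation.

Theorem theorem1p11 (R : realFieldType) (T T' : bintree) (k m n : nat)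
    (hT : tree_size T = k) (hT' : tree_size T' = m)
    (hm : (1 <= m)%N) (hmk : (m <= k)%N) (hn : (k + m + 1 < n)%N) :
  perm_cov (@copies_in_bst R n T) (@copies_in_bst R n T')
    = (n%:R + 1) * sigma R T T'.
Proof.
rewrite perm_cov_mixed.
have -> : n = (k + m + (n - (k + m).+2).+2)%N by lia.
rewrite (mixed_copies_large R hT hT' hm hmk).
rewrite (mean_copies_large R hT) ?(mean_copies_large R hT'); try lia.
by rewrite -!natr1 !natrD; ring.
Qed.
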